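(* Let $\gamma:\mathbb{S}^1\to\mathbb{R}$ have one-homogeneous extension $\gamma(\boldsymbol{p})$ and suppose $$3\gamma(\boldsymbol{n})>\gamma(-\boldsymbol{n})\quad\forall \boldsymbol{n}\in\mathbb{S}^1,\qquad \gamma(\boldsymbol{p})\in C^2(\mathbb{R}^2\setminus\{\boldsymbol{0}\}).$$ Let $k_0$ be the minimal stabilizing function of $\gamma$, and let $k:\mathbb{S}^1\to\mathbb{R}$ be a finite stabilizing function with $k(\boldsymbol{n})\ge k_0(\boldsymbol{n})$ for all $\boldsymbol{n}\in\mathbb{S}^1$. Let $\tau>0$, let $\boldsymbol{X}^0\in[\mathbb{K}^h]^2$ be given by $\boldsymbol{X}^0(\rho_j)=\boldsymbol{X}_0(\rho_j)$, $0\le j\le N$, for an initial closed curve $\boldsymbol{X}_0:\mathbb{T}\to\mathbb{R}^2$, and let $(\boldsymbol{X}^{m+1},\mu^{m+1})\in[\mathbb{K}^h]^2\times\mathbb{K}^h$, $m=0,1,2,\ldots$, satisfy the scheme (SP-PFEM for area-conserved anisotropic curvature flow) $$\Bigl(\boldsymbol{n}^{m+\frac12}\cdot\frac{\boldsymbol{X}^{m+1}-\boldsymbol{X}^m}{\tau},\varphi^h\Bigr)^h_{\Gamma^m}+\Bigl(\mu^{m+1}-\lambda^{m+\frac12},\varphi^h\Bigr)^h_{\Gamma^m}=0\quad\forall\varphi^h\in\mathbb{K}^h,$$ $$\Bigl(\mu^{m+1}\boldsymbol{n}^{m+\frac12},\boldsymbol{\omega}^h\Bigr)^h_{\Gamma^m}-\Bigl(\boldsymbol{G}_k(\boldsymbol{n}^m)\partial_s\boldsymbol{X}^{m+1},\partial_s\boldsymbol{\omega}^h\Bigr)^h_{\Gamma^m}=0\quad\forall\boldsymbol{\omega}^h\in[\mathbb{K}^h]^2,$$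 where $$\lambda^{m+\frac12}=\frac{(\mu^{m+1},1)^h_{\Gamma^m}}{(1,1)^h_{\Gamma^m}},$$ and where $\min_{1\le j\le N}|\boldsymbol{h}_j^m|>0$ for all $m\ge0$. Then $$A^{m+1}=A^0,\qquad W^{m+1}\le W^m\le\cdots\le W^0,\qquad\forall m\ge0.$$
   Context: Rotation: for $\boldsymbol{v}=(v_1,v_2)^T\in\mathbb{R}^2$, $\boldsymbol{v}^\perp=(v_2,-v_1)^T$ (clockwise rotation by $\pi/2$). Anisotropy: the one-homogeneous extension of $\gamma$ is $\gamma(\boldsymbol{p})=|\boldsymbol{p}|\gamma(\boldsymbol{p}/|\boldsymbol{p}|)$ for $\boldsymbol{p}\ne\boldsymbol{0}$, $\gamma(\boldsymbol{0})=0$. The Cahn–Hoffman vector is $\boldsymbol{\xi}=\boldsymbol{\xi}(\boldsymbol{n})=\nabla\gamma(\boldsymbol{p})|_{\boldsymbol{p}=\boldsymbol{n}}$, $\boldsymbol{n}\in\mathbb{S}^1$. For a nonnegative function $k:\mathbb{S}^1\to\mathbb{R}$ (the stabilizing function), the surface energy matrix is $\boldsymbol{G}_k(\boldsymbol{n})=\gamma(\boldsymbol{n})I_2-\boldsymbol{n}\boldsymbol{\xi}^T+\boldsymbol{\xi}\boldsymbol{n}^T+k(\boldsymbol{n})\boldsymbol{n}\boldsymbol{n}^T$. Minimal stabilizing function: for $\boldsymbol{n},\hat{\boldsymbol{n}}\in\mathbb{S}^1$, $\alpha\ge0$, let $P_\alpha(\boldsymbol{n},\hat{\boldsymbol{n}})=2\sqrt{(\gamma(\boldsymbol{n})+\alpha(\hat{\boldsymbol{n}}\cdot\boldsymbol{n}^\perp)^2)\gamma(\boldsymbol{n})}$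 and $Q(\boldsymbol{n},\hat{\boldsymbol{n}})=\gamma(\hat{\boldsymbol{n}})+\gamma(\boldsymbol{n})(\boldsymbol{n}\cdot\hat{\boldsymbol{n}})-(\boldsymbol{\xi}(\boldsymbol{n})\cdot\boldsymbol{n}^\perp)(\hat{\boldsymbol{n}}\cdot\boldsymbol{n}^\perp)$. Then $k_0(\boldsymbol{n})=\inf\{\alpha\ge0:\ P_\alpha(\boldsymbol{n},\hat{\boldsymbol{n}})-Q(\boldsymbol{n},\hat{\boldsymbol{n}})\ge0\ \ \forall\hat{\boldsymbol{n}}\in\mathbb{S}^1\}$. Discretization: $\mathbb{T}=\mathbb{R}/\mathbb{Z}=[0,1]$ (periodic), $N>2$ an integer, $h=1/N$, $\rho_j=jh$ for $0\le j\le N$ (with $\rho_N=\rho_0$ by periodicity), $I_j=[\rho_{j-1},\rho_j]$. $\mathbb{K}^h=\{u\in C(\mathbb{T}):u|_{I_j}\text{ is a polynomial of degree}\le1,\ 1\le j\le N\}$. For $\boldsymbol{X}^m=(x^m,y^m)^T\in[\mathbb{K}^h]^2$, $\Gamma^m=\boldsymbol{X}^m(\mathbb{T})$ is a closed polygonal curve and $\boldsymbol{h}_j^m=\boldsymbol{X}^m(\rho_j)-\boldsymbol{X}^m(\rho_{j-1})$. The normal is the piecewise constant vector $\boldsymbol{n}^m|_{I_j}=\boldsymbol{n}_j^m=-(\boldsymbol{h}_j^m)^\perp/|\boldsymbol{h}_j^m|$, and $\boldsymbol{G}_k(\boldsymbol{n}^m)|_{I_j}=\boldsymbol{G}_k(\boldsymbol{n}_j^m)$.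 Further, $\boldsymbol{n}^{m+\frac12}=-\frac{1}{2|\partial_\rho\boldsymbol{X}^m|}(\partial_\rho\boldsymbol{X}^m+\partial_\rho\boldsymbol{X}^{m+1})^\perp$, i.e. $\boldsymbol{n}^{m+\frac12}|_{I_j}=-\frac{(\boldsymbol{h}_j^m+\boldsymbol{h}_j^{m+1})^\perp}{2|\boldsymbol{h}_j^m|}$. For scalar or vector functions $f$ on $\Gamma^m$, $\partial_sf|_{I_j}=\frac{f(\rho_j)-f(\rho_{j-1})}{|\boldsymbol{h}_j^m|}$. The mass-lumped inner product of (possibly discontinuous at the $\rho_j$) scalar or vector functions is $(u,v)^h_{\Gamma^m}=\frac12\sum_{j=1}^N|\boldsymbol{h}_j^m|\bigl((u\cdot v)(\rho_{j-1}^+)+(u\cdot v)(\rho_j^-)\bigr)$, with one-sided limits. Discrete area and energy: $A^m=\frac12\sum_{j=1}^N(x^m(\rho_j)-x^m(\rho_{j-1}))(y^m(\rho_j)+y^m(\rho_{j-1}))$, $W^m=\sum_{j=1}^N|\boldsymbol{h}_j^m|\gamma(\boldsymbol{n}_j^m)$. *)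

(* Defs.v *)
From mathcomp Require Import all_boot all_order all_algebra.
From mathcomp Require Import all_classical all_reals all_analysis.

Set Implicit Arguments.
Unset Strict Implicit.
Unset Printing Implicit Defensive.

Import Order.TTheory GRing.Theory Num.Theory.
Import numFieldNormedType.Exports.
Local Open Scope classical_set_scope.
Local Open Scope ring_scope.

Section Plane.
Context {R : realType}.
Implicit Types u v n p : 'cV[R]_2.

Definition dot u v : R := \sum_i u i 0 * v i 0.

(* The library norm `|v| on 'cV[R]_2 is the max norm, not the Euclidean one. *)
Definition enorm v : R := Num.sqrt (dot v v).

Definition perp v : 'cV[R]_2 := \col_i (if i == 0 then v 1 0 else - v 0 0).

Definition on_circle n : Prop := enorm n = 1.

(* As U is open, continuity of q |-> Df(q) is continuity of q |-> Df(q) v for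
   every v, because the dimension is finite. *)
Definition C1_on (U : set 'cV[R]_2) (f : 'cV[R]_2 -> R) : Prop :=
  forall p, U p ->
    differentiable f p /\
    forall v, {for p, continuous (fun q => 'D_v f q)}.

Definition C2_on (U : set 'cV[R]_2) (f : 'cV[R]_2 -> R) : Prop :=
  C1_on U f /\ forall v, C1_on U (fun q => 'D_v f q).

Definition gradient (f : 'cV[R]_2 -> R) p : 'cV[R]_2 :=
  \col_i 'D_(delta_mx i 0) f p.

End Plane.

(* Functions on the unit circle (gamma and k) are represented by total
   functions on the plane of which only the values on the circle are used. *)
Section Anisotropy.
Context {R : realType}.
Variable gamma : 'cV[R]_2 -> R.
Implicit Types n nh : 'cV[R]_2.

Definition one_homogeneous_ext (p : 'cV[R]_2) : R :=
  if p == 0 then 0 else enorm p * gamma ((enorm p)^-1 *: p).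

Definition cahn_hoffman n : 'cV[R]_2 := gradient one_homogeneous_ext n.

Definition surface_energy_matrix (k : 'cV[R]_2 -> R) n : 'M[R]_2 :=
  (gamma n)%:M - n *m (cahn_hoffman n)^T + cahn_hoffman n *m n^T
  + k n *: (n *m n^T).

Definition P_stab (alpha : R) n nh : R :=
  2 * Num.sqrt ((gamma n + alpha * dot nh (perp n) ^+ 2) * gamma n).

Definition Q_stab n nh : R :=
  gamma nh + gamma n * dot n nh
  - dot (cahn_hoffman n) (perp n) * dot nh (perp n).

(* Extended-real infimum: it is +oo when no alpha is admissible. *)
Definition k_min n : \bar R :=
  ereal_inf [set alpha%:E | alpha in
    [set alpha : R | 0 <= alpha /\
       forall nh, on_circle nh -> 0 <= P_stab alpha n nh - Q_stab n nh]].

End Anisotropy.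

(* Functions on the torus R/Z are 1-periodic functions on R.  The mesh interval
   I_j, for 1 <= j <= N, is [node N j.-1, node N j]. *)
Section Mesh.
Context {R : realType}.
Variable N : nat.

Definition node (j : nat) : R := j%:R / N%:R.

Definition Kh (u : R -> R) : Prop :=
  [/\ periodic u 1,
      continuous u
    & forall j, (1 <= j <= N)%N ->
        exists p : {poly R}, (size p <= 2)%N /\
          forall x, node j.-1 <= x <= node j -> u x = p.[x]].

Definition Kh2 (X : R -> 'cV[R]_2) : Prop :=
  forall i, Kh (fun x => X x i 0).

(* The piecewise constant periodic function with value c j inside I_j. Its
   values at the nodes are immaterial, since only one-sided limits are used. *)
Definition piecewise_const (V : Type) (c : nat -> V) (x : R) : V :=
  c (Num.truncn (N%:R * (x - (Num.floor x)%:~R))).+1.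

Implicit Types X Y : R -> 'cV[R]_2.

Definition edge X (j : nat) : 'cV[R]_2 := X (node j) - X (node j.-1).

Definition edge_normal X (j : nat) : 'cV[R]_2 :=
  - ((enorm (edge X j))^-1 *: perp (edge X j)).

Definition normal X : R -> 'cV[R]_2 := piecewise_const (edge_normal X).

(* X and Y are the current and the next curve. *)
Definition half_normal X Y : R -> 'cV[R]_2 :=
  piecewise_const (fun j =>
    - ((2 * enorm (edge X j))^-1 *: perp (edge X j + edge Y j))).

(* Arclength derivative of f along the curve X. *)
Definition deriv_s X (f : R -> 'cV[R]_2) : R -> 'cV[R]_2 :=
  piecewise_const (fun j => (enorm (edge X j))^-1 *: edge f j).

Definition mass_lumped X (w : R -> R) : R :=
  2^-1 * \sum_(1 <= j < N.+1)
    enorm (edge X j) * (lim (w x @[x --> (node j.-1)^'+])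
                        + lim (w x @[x --> (node j)^'-])).

Definition inner_s X (u v : R -> R) : R :=
  mass_lumped X (fun x => u x * v x).

Definition inner_v X (u v : R -> 'cV[R]_2) : R :=
  mass_lumped X (fun x => dot (u x) (v x)).

Definition area X : R :=
  2^-1 * \sum_(1 <= j < N.+1)
    (X (node j) 0 0 - X (node j.-1) 0 0) * (X (node j) 1 0 + X (node j.-1) 1 0).

Definition energy (gamma : 'cV[R]_2 -> R) X : R :=
  \sum_(1 <= j < N.+1) enorm (edge X j) * gamma (edge_normal X j).

Definition lagrange_multiplier X (mu : R -> R) : R :=
  inner_s X mu (fun=> 1) / inner_s X (fun=> 1) (fun=> 1).

(* One time step of the scheme, from X to (Y, mu). *)
Definition sp_pfem_step (gamma k : 'cV[R]_2 -> R) (tau : R)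
    X Y (mu : R -> R) : Prop :=
  (forall phi, Kh phi ->
     inner_s X (fun x => dot (half_normal X Y x) (tau^-1 *: (Y x - X x))) phi
     + inner_s X (fun x => mu x - lagrange_multiplier X mu) phi = 0) /\
  (forall omega, Kh2 omega ->
     inner_v X (fun x => mu x *: half_normal X Y x) omega
     - inner_v X
         (fun x => surface_energy_matrix gamma k (normal X x) *m deriv_s X Y x)
         (deriv_s X omega) = 0).

End Mesh.

(* Main.v *)
(* Write h and h' for an edge of X^m and the corresponding edge of X^{m+1}.
   Area: testing the first equation with 1 kills the multiplier term, and the
   lumped sum of n^{m+1/2} . (X^{m+1} - X^m) is A^{m+1} - A^m up to a telescoping
   sum, which vanishes by periodicity.
   Energy: testing with mu^{m+1} and X^{m+1} - X^m bounds
     sum_j |h_j| (G_k d_s X^{m+1}) . d_s (X^{m+1} - X^m)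
   above by -tau times the variance of mu^{m+1}. Each summand is at least
   |h'| gamma(n') - |h| gamma(n): with r = |h'| / |h| this reads
     r^2 (gamma(n) + k(n) (n' . n^perp)^2) + gamma(n) >= r Q(n, n'),
   and the left-hand side is >= r P_k(n, n') by AM-GM. *)
Require Import Defs.
From mathcomp Require Import all_boot all_order all_algebra.
From mathcomp Require Import all_classical all_reals all_analysis.
From mathcomp Require Import ring lra.
Import Order.TTheory GRing.Theory Num.Theory.
Import numFieldNormedType.Exports.
Local Open Scope classical_set_scope.
Local Open Scope ring_scope.

(** * Rotations, unit normals and the surface energy form in the plane *)

Section PlaneGeometry.
Context {R : realType}.
Implicit Types u v n : 'cV[R]_2.

Lemma sum_ord2 (F : 'I_2 -> R) : \sum_i F i = F 0 + F 1.
Proof.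
by rewrite !big_ord_recl big_ord0 addr0; congr (_ + F _); apply: val_inj.
Qed.

Lemma dotE u v : dot u v = u 0 0 * v 0 0 + u 1 0 * v 1 0.
Proof. exact: sum_ord2. Qed.

Lemma perpE v : (perp v 0 0 = v 1 0) * (perp v 1 0 = - v 0 0).
Proof. by rewrite !mxE. Qed.

Lemma dot_eq v : dot v v = enorm v ^+ 2.
Proof. by rewrite sqr_sqrtr// dotE -!expr2 addr_ge0 ?sqr_ge0. Qed.

Lemma on_circle_dot n : on_circle n -> dot n n = 1.
Proof. by rewrite /on_circle dot_eq => ->; rewrite expr1n. Qed.

(** [edge_normal N X j] is convertible to [unit_normal (edge N X j)], so estimates for single
    vectors apply directly to mesh edges. *)
Definition unit_normal v : 'cV[R]_2 := - ((enorm v)^-1 *: perp v).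

Lemma on_circle_unit_normal v : enorm v != 0 ->
  on_circle (unit_normal v).
Proof.
move=> v0; rewrite /on_circle /enorm.
have -> : dot (unit_normal v) (unit_normal v) = 1.
  rewrite dotE !(mxE, perpE)/=.
  transitivity ((enorm v)^-1 ^+ 2 * dot v v); first by rewrite dotE; ring.
  by rewrite dot_eq -exprMn mulVf ?expr1n.
exact: sqrtr1.
Qed.

(** Two clockwise quarter turns give minus the identity, and the sign in [unit_normal] cancels
    it. *)
Lemma perp_unit_normal v : enorm v != 0 ->
  v = enorm v *: perp (unit_normal v).
Proof.
move=> v0; apply/colP => i; have [->|->] : i = 0 \/ i = 1.
- by case: i => [[|[|//]]] ?; [left|right]; apply: val_inj.
- by rewrite !(mxE, perpE)/=; field.
- by rewrite !(mxE, perpE)/=; field.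
Qed.

Lemma dot_surface_energy (gamma k : 'cV[R]_2 -> R) n u v :
  dot (surface_energy_matrix gamma k n *m u) v =
  gamma n * dot u v - dot (cahn_hoffman gamma n) u * dot n v
  + dot n u * dot (cahn_hoffman gamma n) v + k n * dot n u * dot n v.
Proof.
(* The identity holds for any vector [xi]; generalizing keeps [mxE] from opening the gradient. *)
rewrite /surface_energy_matrix; move: (cahn_hoffman _ _) => xi.
rewrite !dotE !mxE !sum_ord2 !mxE !big_ord1 !mxE/=; ring.
Qed.

End PlaneGeometry.

(** * The energy estimate on a single edge *)

Section LocalEnergyEstimate.
Context {R : realType}.
Implicit Types n nh : 'cV[R]_2.
Variables gamma k : 'cV[R]_2 -> R.
Hypothesis gamma_ratio : forall n, on_circle n -> gamma (- n) < 3 * gamma n.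
Hypothesis k_ge_min : forall n, on_circle n -> (k_min gamma n <= (k n)%:E)%E.
Hypothesis k_ge0 : forall n, on_circle n -> 0 <= k n.

(** The ratio condition at [n] and at [- n] gives gamma(n) < 3 gamma(-n) < 9 gamma(n). *)
Lemma gamma_gt0 n : on_circle n -> 0 < gamma n.
Proof.
move=> n1; have := gamma_ratio _ n1; have : on_circle (- n).
  by move: n1; rewrite /on_circle /enorm !dotE !mxE !mulrNN.
move=> /gamma_ratio; rewrite opprK; lra.
Qed.

(* The infimum k_min is attained, since P_stab is continuous in alpha. *)
Lemma P_stab_ge_Q n nh : on_circle n -> on_circle nh ->
  Q_stab gamma n nh <= P_stab gamma (k n) n nh.
Proof.
move=> n1 nh1; rewrite leNgt; apply/negP => PQ.
have g0 := ltW (gamma_gt0 _ n1); have k0 := k_ge0 _ n1.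
set Q := Q_stab gamma n nh.
have [c c0 cE] : exists2 c, 0 <= c & dot nh (perp n) ^+ 2 = c.
  by exists (dot nh (perp n) ^+ 2); rewrite ?sqr_ge0.
have r0 alpha : 0 <= alpha -> 0 <= (gamma n + alpha * c) * gamma n.
  by move=> a0; rewrite mulr_ge0 ?addr_ge0 ?mulr_ge0.
have P2 alpha : 0 <= alpha ->
    P_stab gamma alpha n nh ^+ 2 = 4 * ((gamma n + alpha * c) * gamma n).
  by move=> a0; rewrite /P_stab cE exprMn sqr_sqrtr ?r0//; ring.
have P0 alpha : 0 <= P_stab gamma alpha n nh by rewrite mulr_ge0 ?sqrtr_ge0.
have Q0 : 0 <= Q by exact: le_trans (ltW PQ).
have d0 : 0 < Q ^+ 2 - P_stab gamma (k n) n nh ^+ 2.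
  by rewrite subr_gt0 ltr_pXn2r ?nnegrE.
set d := Q ^+ 2 - _ in d0.
have t0 : 0 <= 4 * gamma n * c by rewrite !mulr_ge0.
(* The square of [P_stab] is affine in [alpha] with slope [t]. Raising [alpha] above [k n] by less
   than [e] gains at most [t * e = d - e], which does not close the gap [d]. The [+ 1] covers
   [t = 0]. *)
set t := 4 * gamma n * c in t0; set e := d / (t + 1).
have e0 : 0 < e by rewrite divr_gt0// ltr_wpDl.
have te : t * e + e = d by rewrite /e; field; rewrite gt_eqF// ltr_wpDl.
have : (k_min gamma n < (k n + e)%:E)%E.
  by rewrite (le_lt_trans (k_ge_min _ n1))// lte_fin ltrDl.
move=> /ereal_inf_lt[_ [alpha [a0 /(_ _ nh1) QP] <-]].
rewrite lte_fin => ak; rewrite subr_ge0 in QP.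
have : Q ^+ 2 <= P_stab gamma alpha n nh ^+ 2 by rewrite ler_pXn2r ?nnegrE.
have -> : Q ^+ 2 = d + P_stab gamma (k n) n nh ^+ 2 by rewrite /d subrK.
rewrite !P2//; apply/negP; rewrite -ltNge.
have -> : 4 * ((gamma n + alpha * c) * gamma n) =
  t * (alpha - k n) + 4 * ((gamma n + k n * c) * gamma n) by rewrite /t; ring.
rewrite ltrD2r.
have : t * (alpha - k n) <= t * e by rewrite ler_wpM2l// lerBlDl ltW.
lra.
Qed.

(** Here [perp n] and [r *: perp nh] stand for the old and the new edge, both divided by the old
    length. *)
Lemma surface_energy_unit_ge n nh (r : R) : on_circle n -> on_circle nh ->
  0 <= r ->
  r * gamma nh - gamma n <=
  dot (surface_energy_matrix gamma k n *m (r *: perp nh))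
      (r *: perp nh - perp n).
Proof.
move=> n1 nh1 r0; have PQ := P_stab_ge_Q _ _ n1 nh1.
have g0 := ltW (gamma_gt0 _ n1); have k0 := k_ge0 _ n1.
set s := gamma n + k n * dot nh (perp n) ^+ 2.
have s0 : 0 <= s by rewrite addr_ge0// mulr_ge0// sqr_ge0.
have amgm : r * P_stab gamma (k n) n nh <= r ^+ 2 * s + gamma n.
  rewrite /P_stab -/s sqrtrM//.
  have := sqr_ge0 (r * Num.sqrt s - Num.sqrt (gamma n)).
  have -> : (r * Num.sqrt s - Num.sqrt (gamma n)) ^+ 2 =
      r ^+ 2 * (Num.sqrt s ^+ 2) + Num.sqrt (gamma n) ^+ 2
      - r * (2 * (Num.sqrt s * Num.sqrt (gamma n))) by ring.
  by rewrite !sqr_sqrtr ?subr_ge0.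
(* The terms in [xi] of order [r ^+ 2] cancel by antisymmetry. The last summand, zero for a unit
   [nh], turns the equality into a polynomial identity. *)
have -> : dot (surface_energy_matrix gamma k n *m (r *: perp nh))
    (r *: perp nh - perp n) =
  r ^+ 2 * s + gamma n - r * Q_stab gamma n nh + (r * gamma nh - gamma n)
  + r ^+ 2 * gamma n * (dot nh nh - 1).
  rewrite dot_surface_energy /s /Q_stab.
  move: (cahn_hoffman _ _) => xi; rewrite !dotE !(mxE, perpE)/=; ring.
have : r * Q_stab gamma n nh <= r * P_stab gamma (k n) n nh.
  exact: ler_wpM2l.
rewrite (on_circle_dot _ nh1) subrr mulr0 addr0.
lra.
Qed.

(** This is the unit estimate with [r] the ratio of the lengths of [f] and [e], multiplied by the
    length of [e]. *)
Lemma surface_energy_edge_ge (e f : 'cV[R]_2) :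
  0 < enorm e -> 0 < enorm f ->
  enorm f * gamma (unit_normal f) - enorm e * gamma (unit_normal e) <=
  enorm e *
    dot (surface_energy_matrix gamma k (unit_normal e) *m ((enorm e)^-1 *: f))
        ((enorm e)^-1 *: (f - e)).
Proof.
move=> e0 f0; have en0 := lt0r_neq0 e0; have fn0 := lt0r_neq0 f0.
have r0 : 0 <= (enorm e)^-1 * enorm f by rewrite mulr_ge0 ?invr_ge0 ?sqrtr_ge0.
have := surface_energy_unit_ge _ _ _ (on_circle_unit_normal _ en0)
  (on_circle_unit_normal _ fn0) r0.
rewrite -scalerA -perp_unit_normal// -(ler_pM2l e0).
have -> : perp (unit_normal e) = (enorm e)^-1 *: e.
  by rewrite {3}(perp_unit_normal _ en0) scalerA mulVf// scale1r.
by rewrite -scalerBr mulrBr !mulrA mulfV// mul1r.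
Qed.

End LocalEnergyEstimate.

(** * The mass-lumped product as a trapezoidal sum *)

Section MassLumping.
Context {R : realType}.
Variable N : nat.
Implicit Types X Y : R -> 'cV[R]_2.

Lemma Kh_cst (c : R) : Kh N (fun=> c).
Proof.
split=> [x //|x|j _]; first exact: cvg_cst.
by exists c%:P; split=> [|x _]; rewrite ?hornerC//
  (leq_trans (size_polyC_leq1 _)).
Qed.

Lemma KhB (u v : R -> R) : Kh N u -> Kh N v -> Kh N (fun x => u x - v x).
Proof.
move=> [pu cu lu] [pv cv lv]; split=> [x|x|j jN].
- by rewrite pu pv.
- by apply: cvgB; [exact: cu|exact: cv].
- have [p [sp pE]] := lu _ jN; have [q [sq qE]] := lv _ jN.
  exists (p - q); split=> [|x xj]; last by rewrite !hornerE pE// qE.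
  by rewrite (leq_trans (size_polyD _ _))// geq_max size_polyN sp.
Qed.

Lemma Kh2B X Y : Kh2 N X -> Kh2 N Y -> Kh2 N (fun x => X x - Y x).
Proof.
move=> hX hY i; have := KhB _ _ (hX i) (hY i).
by congr Kh; apply/funext => x; rewrite !mxE.
Qed.

Lemma continuous_dot X Y : (forall i, continuous (fun x => X x i 0)) ->
  (forall i, continuous (fun x => Y x i 0)) ->
  continuous (fun x => dot (X x) (Y x)).
Proof.
move=> cX cY; have -> : (fun x => dot (X x) (Y x)) =
    (fun x => X x 0 0 * Y x 0 0 + X x 1 0 * Y x 1 0).
  by apply/funext => x; rewrite dotE.
by move=> x; apply: cvgD; apply: cvgM; (exact: cX || exact: cY).
Qed.

Lemma node_lt j : (0 < j <= N)%N -> node N j.-1 < node N j :> R.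
Proof.
case: j => // j /= jN.
by rewrite /node ltr_pM2r ?ltr_nat// invr_gt0 ltr0n (leq_trans _ jN).
Qed.

(** Inside I_j the floor of x is 0 and N x lies strictly between j - 1 and j, so the truncation is j
    - 1 and its successor is j. *)
Lemma piecewise_constE (V : Type) (c : nat -> V) j (x : R) :
  (0 < j <= N)%N -> node N j.-1 < x < node N j -> piecewise_const N c x = c j.
Proof.
case: j => // j /= jN; rewrite /node => /andP[jx xj].
have N0 : 0 < N%:R :> R by rewrite ltr0n (leq_trans _ jN).
rewrite ltr_pdivrMr// in jx; rewrite ltr_pdivlMr// in xj.
have x0 : 0 <= x.
  by rewrite -(pmulr_lge0 _ N0) (le_trans _ (ltW jx))// ler0n.
have x1 : x < 1.
  by rewrite -(ltr_pM2r N0) mul1r (lt_le_trans xj)// ler_nat.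
have -> : piecewise_const N c x = c (Num.truncn (N%:R * x)).+1.
  rewrite /piecewise_const (_ : Num.floor x = 0) ?subr0//.
  by apply: floor_def; rewrite x0.
by congr (c _.+1); apply: truncn_def; rewrite mulrC (ltW jx).
Qed.

(** The integrand may jump at the nodes, so it is given by one function [g j] per interval; endpoint
    values then replace one-sided limits. *)
Definition trapezoid X (g : nat -> R -> R) : R :=
  2^-1 * \sum_(1 <= j < N.+1)
    enorm (edge N X j) * (g j (node N j.-1) + g j (node N j)).

(** Both one-sided limits see [w] only inside I_j, where it agrees with the continuous [g j]. *)
Lemma mass_lumpedE X (w : R -> R) (g : nat -> R -> R) :
  (forall j, continuous (g j)) ->
  (forall j x, (0 < j <= N)%N -> node N j.-1 < x < node N j -> w x = g j x) ->
  mass_lumped N X w = trapezoid X g.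
Proof.
move=> cg wg; rewrite /mass_lumped /trapezoid; congr (_ * _).
apply: eq_big_nat => j jN; have lt_j := node_lt _ jN.
congr (_ * (_ + _)); apply: cvg_lim => //.
- apply: cvg_trans (cvg_at_right_filter (cg j _)).
  apply: near_eq_cvg; near=> x; apply/esym/wg => //; apply/andP; split.
    by near: x; exact: nbhs_right_gt.
  by near: x; exact: nbhs_right_lt.
- apply: cvg_trans (cvg_at_left_filter (cg j _)).
  apply: near_eq_cvg; near=> x; apply/esym/wg => //; apply/andP; split.
    by near: x; exact: nbhs_left_gt.
  by near: x; exact: nbhs_left_lt.
Unshelve. all: by end_near. Qed.

Lemma trapezoidD X g1 g2 :
  trapezoid X (fun j x => g1 j x + g2 j x) = trapezoid X g1 + trapezoid X g2.
Proof.
rewrite /trapezoid -mulrDr -big_split; congr (_ * _).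
by apply: eq_bigr => j _ /=; ring.
Qed.

Lemma trapezoidZ X (a : R) g :
  trapezoid X (fun j x => a * g j x) = a * trapezoid X g.
Proof.
rewrite /trapezoid [RHS]mulrCA [in RHS]mulr_sumr; congr (_ * _).
by apply: eq_bigr => j _ /=; ring.
Qed.

Lemma trapezoid_ge0 X g : (forall j x, 0 <= g j x) -> 0 <= trapezoid X g.
Proof.
move=> g0; rewrite mulr_ge0 ?invr_ge0// sumr_ge0// => j _.
by rewrite mulr_ge0 ?addr_ge0 ?sqrtr_ge0.
Qed.

Lemma eq_trapezoid X g1 g2 : (forall j x, g1 j x = g2 j x) ->
  trapezoid X g1 = trapezoid X g2.
Proof. by move=> g12; congr (_ * _); apply: eq_bigr => j _; rewrite !g12. Qed.

Lemma trapezoid_cst X (g : nat -> R) :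
  trapezoid X (fun j _ => g j) = \sum_(1 <= j < N.+1) enorm (edge N X j) * g j.
Proof.
rewrite /trapezoid mulr_sumr; apply: eq_bigr => j _.
by rewrite -mulr2n; field.
Qed.

(** This is the length of the polygon, the denominator of the multiplier. *)
Lemma trapezoid1_gt0 X : (0 < N)%N ->
  (forall j, (1 <= j <= N)%N -> 0 < enorm (edge N X j)) ->
  0 < trapezoid X (fun _ _ => 1).
Proof.
move=> N0 e0; rewrite (trapezoid_cst _ (fun=> 1)) big_nat_recl//.
rewrite ltr_pwDl ?mulr1 ?e0// sumr_ge0// => j _.
by rewrite mulr1 sqrtr_ge0.
Qed.

End MassLumping.

(** * One time step: area conservation and energy decay *)

Section Step.
Context {R : realType}.
Variables (N : nat) (gamma k : 'cV[R]_2 -> R) (tau : R).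
Variables (X Y : R -> 'cV[R]_2) (mu : R -> R).
Hypothesis X_Kh : Kh2 N X.
Hypothesis Y_Kh : Kh2 N Y.
Hypothesis mu_Kh : Kh N mu.
Hypothesis N_gt0 : (0 < N)%N.
Hypothesis tau_gt0 : 0 < tau.
Hypothesis X_edge : forall j, (1 <= j <= N)%N -> 0 < enorm (edge N X j).
Hypothesis step : sp_pfem_step N gamma k tau X Y mu.

(** The constant value of [half_normal N X Y] inside I_j. *)
Let nu j := - ((2 * enorm (edge N X j))^-1 *: perp (edge N X j + edge N Y j)).
Let d x := Y x - X x.
Let lambda := lagrange_multiplier N X mu.

Let Kh2_continuous (Z : R -> 'cV[R]_2) : Kh2 N Z ->
  forall i, continuous (fun x => Z x i 0).
Proof. by move=> hZ i; case: (hZ i). Qed.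

Let mu_continuous : continuous mu. Proof. by case: mu_Kh. Qed.

Let d_Kh : Kh2 N d. Proof. exact: Kh2B. Qed.

Let nu_d_continuous j : continuous (fun x => dot (nu j) (d x)).
Proof.
apply: continuous_dot (Kh2_continuous _ d_Kh) => i x; exact: cvg_cst.
Qed.

Lemma velocity_equation phi : Kh N phi ->
  tau^-1 * trapezoid N X (fun j x => dot (nu j) (d x) * phi x) +
  trapezoid N X (fun _ x => (mu x - lambda) * phi x) = 0.
Proof.
move=> phi_Kh; have [_ phi_continuous _] := phi_Kh.
rewrite -(step.1 _ phi_Kh) -trapezoidZ; congr (_ + _); apply/esym.
- apply: mass_lumpedE => [j x|j x jN xj].
    apply: cvgMl_tmp.
    by apply: cvgM; [exact: nu_d_continuous|exact: phi_continuous].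
  by rewrite /half_normal (piecewise_constE _ _ _ _ _ jN xj) !dotE !mxE; ring.
- apply: mass_lumpedE => // _ x; apply: cvgM; last exact: phi_continuous.
  by apply: cvgB; [exact: mu_continuous|exact: cvg_cst].
Qed.

(** The elastic term is constant on each edge, so its trapezoidal sum collapses to a plain sum over
    edges. *)
Lemma curvature_equation omega : Kh2 N omega ->
  trapezoid N X (fun j x => dot (nu j) (omega x) * mu x) =
  \sum_(1 <= j < N.+1) enorm (edge N X j) *
    dot (surface_energy_matrix gamma k (edge_normal N X j) *m
          ((enorm (edge N X j))^-1 *: edge N Y j))
        ((enorm (edge N X j))^-1 *: edge N omega j).
Proof.
move=> omega_Kh; have /subr0_eq E := step.2 _ omega_Kh.
rewrite -trapezoid_cst; apply: etrans (etrans E _); first apply/esym.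
- apply: mass_lumpedE => [j x|j x jN xj].
    apply: cvgM; last exact: mu_continuous.
    apply: continuous_dot (Kh2_continuous _ omega_Kh) _ => i y; exact: cvg_cst.
  by rewrite /half_normal (piecewise_constE _ _ _ _ _ jN xj) !dotE !mxE; ring.
- apply: mass_lumpedE => [j x|j x jN xj]; first exact: cvg_cst.
  by rewrite /normal /deriv_s !(piecewise_constE _ _ _ _ _ jN xj).
Qed.

(** [lambda] is the lumped mean of [mu]; positivity of the length allows the division to be
    undone. *)
Lemma multiplier_mean : trapezoid N X (fun _ x => mu x - lambda) = 0.
Proof.
have t1 := trapezoid1_gt0 N X N_gt0 X_edge.
have E1 : inner_s N X (fun=> 1) (fun=> 1) = trapezoid N X (fun _ _ => 1).
  by apply: mass_lumpedE => [j x|j x _ _]; [exact: cvg_cst|rewrite mulr1].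
have Emu : inner_s N X mu (fun=> 1) = trapezoid N X (fun=> mu).
  by apply: mass_lumpedE => [j|j x _ _]; rewrite ?mulr1.
rewrite (trapezoidD _ _ (fun=> mu) (fun _ _ => - lambda)).
rewrite (eq_trapezoid _ _ (fun _ _ => - lambda) (fun _ _ => - lambda * 1)).
  rewrite trapezoidZ /lambda /lagrange_multiplier E1 Emu.
  by rewrite mulNr divfK ?subrr ?gt_eqF.
by move=> *; rewrite mulr1.
Qed.

Lemma area_rate : trapezoid N X (fun j x => dot (nu j) (d x)) = 0.
Proof.
have := velocity_equation _ (Kh_cst _ 1).
rewrite (eq_trapezoid _ _ _ (fun j x => dot (nu j) (d x)))//; last first.
  by move=> *; rewrite mulr1.
rewrite (eq_trapezoid _ _ (fun _ x => _ * 1) (fun _ x => mu x - lambda));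
  last first.
  by move=> *; rewrite mulr1.
rewrite multiplier_mean addr0 => /eqP; rewrite mulf_eq0 invr_eq0 gt_eqF//=.
by move/eqP.
Qed.

(* As [mu - lambda] has mean zero, testing with [mu] amounts to testing with
   [mu - lambda]. *)
Lemma dissipation : trapezoid N X (fun j x => dot (nu j) (d x) * mu x) <= 0.
Proof.
have := velocity_equation _ mu_Kh.
rewrite (eq_trapezoid _ _ (fun _ x => (mu x - lambda) * mu x)
  (fun _ x => (mu x - lambda) ^+ 2 + lambda * (mu x - lambda))); last first.
  by move=> *; ring.
rewrite (trapezoidD _ _ (fun _ x => (mu x - lambda) ^+ 2)).
rewrite trapezoidZ multiplier_mean mulr0 addr0 => /eqP.
rewrite addr_eq0 => /eqP E.
have : tau^-1 * trapezoid N X (fun j x => dot (nu j) (d x) * mu x) <= 0.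
  by rewrite E oppr_le0 trapezoid_ge0// => *; exact: sqr_ge0.
by rewrite pmulr_rle0 ?invr_gt0.
Qed.

Lemma Kh2_node_periodic (Z : R -> 'cV[R]_2) : Kh2 N Z ->
  Z (node N N) = Z (node N 0).
Proof.
move=> hZ; apply/matrixP => i j; rewrite ord1; have [pZ _ _] := hZ i.
rewrite /node mul0r divff ?pnatr_eq0 -?lt0n//.
by have := pZ 0; rewrite add0r.
Qed.

Lemma area_step : area N Y = area N X.
Proof.
apply/eqP; rewrite -subr_eq0; apply/eqP; rewrite -[RHS]area_rate.
(* For the linear motion from [X] to [Y], integrating the rate of change of the area by parts leaves
   this boundary term: horizontal displacement times mean height. *)
pose b j := 2^-1 * ((Y (node N j) 0 0 - X (node N j) 0 0) *
                    (X (node N j) 1 0 + Y (node N j) 1 0)).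
have tele : \sum_(1 <= j < N.+1) (b j - b j.-1) = 0.
  rewrite big_add1 /= telescope_sumr// /b.
  by rewrite (Kh2_node_periodic _ X_Kh) (Kh2_node_periodic _ Y_Kh) subrr.
apply/eqP; rewrite -subr_eq0 -[X in _ == X]tele.
rewrite /area /trapezoid -!mulrBr -!sumrB mulr_sumr.
(* The identity now holds edge by edge: the length weight cancels the one in [nu], leaving
   polynomials in the vertices. *)
apply/eqP/eq_big_nat => j jN; have /lt0r_neq0 := X_edge _ jN.
rewrite /nu /b /d !dotE !mxE /=.
by move: (enorm _) => e e0; field.
Qed.

Lemma energy_step
  (gamma_ratio : forall n, on_circle n -> gamma (- n) < 3 * gamma n)
  (k_ge0 : forall n, on_circle n -> 0 <= k n)
  (k_ge_min : forall n, on_circle n -> (k_min gamma n <= (k n)%:E)%E)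
  (Y_edge : forall j, (1 <= j <= N)%N -> 0 < enorm (edge N Y j)) :
  energy N gamma Y <= energy N gamma X.
Proof.
rewrite -subr_le0; apply: le_trans dissipation.
rewrite (curvature_equation _ d_Kh) /energy -sumrB.
apply: ler_sum_nat => j jN.
have -> : edge N d j = edge N Y j - edge N X j.
  by apply/matrixP => i l; rewrite /edge /d !mxE; ring.
exact: (surface_energy_edge_ge _ _ gamma_ratio k_ge_min k_ge0 _ _
  (X_edge _ jN) (Y_edge _ jN)).
Qed.

End Step.

(** * Iteration over the time steps *)

Theorem theorem4p2 (R : realType) (gamma k : 'cV[R]_2 -> R)
    (gamma_ratio : forall n, on_circle n -> gamma (- n) < 3 * gamma n)
    (gamma_C2 : C2_on [set p | p != 0] (one_homogeneous_ext gamma))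
    (k_ge0 : forall n, on_circle n -> 0 <= k n)
    (k_ge_min : forall n, on_circle n -> (k_min gamma n <= (k n)%:E)%E)
    (N : nat) (N_gt2 : (2 < N)%N)
    (tau : R) (tau_gt0 : 0 < tau)
    (X0 : R -> 'cV[R]_2) (X0_periodic : periodic X0 1)
    (X0_continuous : continuous X0)
    (X : nat -> R -> 'cV[R]_2) (mu : nat -> R -> R)
    (X_Kh : forall m, Kh2 N (X m))
    (mu_Kh : forall m, Kh N (mu m.+1))
    (X_init : forall j, (j <= N)%N -> X 0%N (node N j) = X0 (node N j))
    (scheme : forall m, sp_pfem_step N gamma k tau (X m) (X m.+1) (mu m.+1))
    (edge_gt0 : forall m j, (1 <= j <= N)%N -> 0 < enorm (edge N (X m) j)) :
  forall m : nat,
    area N (X m.+1) = area N (X 0%N) /\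
    (forall i, (i <= m)%N -> energy N gamma (X i.+1) <= energy N gamma (X i)).
Proof.
have N_gt0 : (0 < N)%N by exact: ltn_trans N_gt2.
move=> m; split.
- elim: m => [|m <-]; exact: (area_step _ _ _ _ _ _ _ (X_Kh _) (X_Kh _)
    (mu_Kh _) N_gt0 tau_gt0 (edge_gt0 _) (scheme _)).
- move=> i _; exact: (energy_step _ _ _ _ _ _ _ (X_Kh _) (X_Kh _) (mu_Kh _)
    N_gt0 tau_gt0 (edge_gt0 _) (scheme _) gamma_ratio k_ge0 k_ge_min
    (edge_gt0 _)).
Qed.
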